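(* For each primitive set $\mathscr{B}\subset\mathbb{N}\setminus\{1\}$, $$\mathrm{cpx}_{X_{\mathscr{B}}}(n)\ge (2+o(1))^{\frac{n}{\log n}}\quad\text{as } n\to\infty,$$ i.e. there is a sequence $\varepsilon_n\to0$ such that $\mathrm{cpx}_{X_{\mathscr{B}}}(n)\ge(2+\varepsilon_n)^{n/\log n}$ for all sufficiently large $n$.
   Context: $\mathbb{N}=\{1,2,\ldots\}$; $\log$ is the natural logarithm. $\mathscr{B}$ is primitive if no element of $\mathscr{B}$ divides a different element of $\mathscr{B}$. A set $A\subset\mathbb{Z}$ is $\mathscr{B}$-admissible if for every $b\in\mathscr{B}$ it misses at least one residue class modulo $b$; $X_{\mathscr{B}}$ is the set of all $x\in\{0,1\}^{\mathbb{Z}}$ whose support $\{i:x(i)=1\}$ is $\mathscr{B}$-admissible. $\mathrm{cpx}_{X}(n)$ is the number of distinct blocks of length $n$ appearing in elements of $X$. *)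

(* Defs.v *)
From mathcomp Require Import all_boot all_order all_algebra.
From mathcomp Require Import all_classical all_reals all_analysis.
Import Order.TTheory GRing.Theory Num.Theory.
Import numFieldNormedType.Exports.

Set Implicit Arguments.
Unset Strict Implicit.
Unset Printing Implicit Defensive.

Local Open Scope classical_set_scope.
Local Open Scope ring_scope.

Definition primitive_set (B : set nat) : Prop :=
  forall a b : nat, B a -> B b -> a != b -> ~~ (a %| b)%N.

Definition admissible (B : set nat) (A : set int) : Prop :=
  forall b : nat, B b ->
    exists r : int, forall a : int, A a -> (a != r %[mod b%:Z])%Z.

Definition support_set (x : int -> bool) : set int := [set i | x i].

Definition admissible_shift (B : set nat) : set (int -> bool) :=
  [set x | admissible B (support_set x)].

Definition appears (X : set (int -> bool)) (n : nat) (w : {ffun 'I_n -> bool})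
    : Prop :=
  exists2 x, X x & exists i : int, forall j : 'I_n, w j = x (i + (j : nat)%:Z).

Definition cpx (X : set (int -> bool)) (n : nat) : nat :=
  #|[set w : {ffun 'I_n -> bool} | `[< appears X w >]]%SET|.

(* Main.v *)
Require Import Defs.
From mathcomp Require Import all_boot all_order all_algebra zify ring lra.
From mathcomp Require Import all_classical all_reals all_analysis.
Import Order.TTheory GRing.Theory Num.Theory.
Import numFieldNormedType.Exports.

(** If a block of n consecutive integers contains m primes larger than m, these
m primes form an admissible set: modulo b they miss the class 0 if b has a prime
factor p <= m, and they are too few to meet every class if b > m.  All their
subsets are admissible too, so cpx n >= 2 ^ m.

Such a block exists for m ~ n / log n without the prime number theorem.
Otherwise, for a fixed large K, each block [kn, (k+1)n) with 1 <= k < K has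
fewer than m primes and [0, n) has at most 2m.  By Legendre's formula, primes of
block k >= 1 occur at most K/k times in (Kn)!, whereas a prime p < n occurs in
(Kn)! / (n!)^K with p-part at most (Kn)^K.  Hence
  (Kn)! <= (n!)^K (Kn)^E  with  E <= K m (3 + log K),
and Stirling's lower bound gives
  n (log K - 1) <= m (3 + log K) (log K + log n),
which fails for m <= (1 - d) n / log n + 1 once K and then n are large. *)

Set Implicit Arguments.
Unset Strict Implicit.
Unset Printing Implicit Defensive.

Section PrimesInBlocks.
Local Open Scope nat_scope.

(** * Admissible sets of primes and the number of blocks *)

Lemma modz_nat_eq (a c b : nat) :
  (a%:Z == c%:Z %[mod b%:Z])%Z = (a == c %[mod b]).
Proof. by rewrite !modz_nat eqz_nat. Qed.

Lemma primes_miss_class (n i m : nat) (S : {set 'I_n}) (b : nat) :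
    1 < b -> #|S| <= m ->
    {in S, forall j : 'I_n, prime (i + j) && (m < i + j)} ->
  exists r : nat, {in S, forall j : 'I_n, i + j != r %[mod b]}.
Proof.
move=> b1 leSm primeS; have [lepm|ltmp] := leqP (pdiv b) m.
  exists 0 => j /primeS /andP[pij ltmij]; rewrite mod0n.
  apply/negP => /(dvdn_trans (pdiv_dvd b)).
  by rewrite dvdn_prime2 ?pdiv_prime// => /eqP pE;
    rewrite pE leqNgt ltmij in lepm.
have b0 : 0 < b by apply: ltnW.
pose res (j : 'I_n) : 'I_b := Ordinal (ltn_pmod (i + j) b0).
have : #|(res @: S)%SET| < #|'I_b|.
  rewrite card_ord (leq_ltn_trans (leq_imset_card _ _))//.
  rewrite (leq_ltn_trans leSm)//.
  by rewrite (leq_trans ltmp)// pdiv_leq.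
rewrite ltnNge -cardsT => /negP not_full.
have /subsetPn[r _ rNS] : ~~ ([set: 'I_b] \subset (res @: S))%SET.
  by apply/negP => /subset_leq_card /not_full.
exists r => j jS; apply: contra rNS => /eqP ijr.
apply/imsetP; exists j => //; apply/val_inj.
by rewrite /= ijr modn_small.
Qed.

Lemma cpx_ge_exp2 (B : set nat) (n i m : nat) :
    (forall b, B b -> 1 < b) ->
    m <= #|[set j : 'I_n | prime (i + j) && (m < i + j)]%SET| ->
  2 ^ m <= cpx (admissible_shift B) n.
Proof.
(* Exactly [m] primes are selected: with more, the set might meet every class modulo some [b] whose
   prime factors all exceed [m]. *)
move=> B1 /card_geqP[s [uniq_s size_s sub_s]].
pose S := [set j in s]%SET.
have cardS : #|S| = m by rewrite cardsE (card_uniqP uniq_s).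
have primeS : {in S, forall j : 'I_n, prime (i + j) && (m < i + j)}.
  by move=> j; rewrite inE => /sub_s; rewrite inE.
pose word (T : {set 'I_n}) : {ffun 'I_n -> bool} := [ffun j => j \in T].
have word_inj : injective word.
  by move=> T U /ffunP TU; apply/setP => j; have := TU j; rewrite !ffunE.
rewrite -cardS -card_powerset -(card_imset _ word_inj).
apply/subset_leq_card/fintype.subsetP => _ /imsetP[T + ->].
rewrite powersetE inE => /fintype.subsetP subTS; apply/asboolP.
(* The word is extended by zeros, so the support is the translate [i + T] and contains only selected
   primes. *)
exists (fun z : int => [exists j : 'I_n, (j \in T) && (z == Posz (i + j))]).
  move=> b /B1 b1; have leSm : #|S| <= m by rewrite cardS.
  have [r rP] := primes_miss_class b1 leSm primeS.
  exists (Posz r) => _ /existsP[j /andP[/subTS jS /eqP ->]].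
  by rewrite modz_nat_eq rP.
exists (Posz i) => j; rewrite ffunE.
apply/idP/existsP => [jT|[k /andP[kT /eqP eqjk]]].
  by exists j; rewrite jT PoszD eqxx.
by have <- : k = j by apply/val_inj => /=; lia.
Qed.

(** * Prime factorization of factorials *)

Lemma logn_fact_trunc (p m T : nat) : prime p -> m < p ^ T.+1 ->
  logn p m`! = \sum_(1 <= k < T.+1) m %/ p ^ k.
Proof.
move=> pp ltm; rewrite logn_fact//.
have bigT k : T < k -> m < p ^ k.
  by move=> ltTk; rewrite (leq_trans ltm)// leq_pexp2l// prime_gt0.
have bigm k : m < k -> m < p ^ k.
  by move=> ltmk; rewrite (ltn_trans ltmk)// ltn_expl// prime_gt1.
have [leTm|/ltnW lemT] := leqP T m.
  rewrite (big_cat_nat (n := T.+1))//= [X in _ + X]big1_seq ?addn0//.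
  move=> k /andP[_].
  by rewrite mem_index_iota => /andP[/bigT lt_k _]; rewrite divn_small.
rewrite [RHS](big_cat_nat (n := m.+1))//=.
rewrite [X in _ = _ + X]big1_seq ?addn0// => k /andP[_].
by rewrite mem_index_iota => /andP[/bigm lt_k _]; rewrite divn_small.
Qed.

(** The range up to a common [N] allows two factorials to be compared prime by prime; primes above
    [n] contribute a factor 1. *)
Lemma fact_prod_logn (n N : nat) : n <= N ->
  n`! = \prod_(0 <= p < N.+1 | prime p) p ^ logn p n`!.
Proof.
move=> leqnN.
rewrite -{1}(partnT (fact_gt0 n)).
rewrite (@widen_partn (maxn N n`!)) ?leq_maxr//.
rewrite (big_cat_nat (n := N.+1)) //=; last by rewrite ltnS leq_maxl.
rewrite [X in _ * X]big1_seq ?muln1; last first.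
  move=> p /andP[_]; rewrite mem_index_iota => /andP[ltNp _].
  case: (boolP (prime p)) => [pp|npp]; last by rewrite lognE (negbTE npp).
  by rewrite (@logn_fact_trunc _ _ 0) ?big_geq// expn1 (leq_ltn_trans leqnN).
rewrite [RHS]big_mkcond /=; apply: eq_bigr => p _.
by case: ifP => // npp; rewrite lognE npp.
Qed.

(** In Legendre's formula, each power [q] of [p] up to [K * n] costs at most [K], because
    [n < q * (n %/ q + 1)] gives [K * n %/ q <= K * (n %/ q) + K]. *)
Lemma logn_fact_mul (p K n : nat) : prime p -> 0 < K * n ->
  logn p (K * n)`! <= K * logn p n`! + K * trunc_log p (K * n).
Proof.
move=> pp Kn0; set t := trunc_log p (K * n).
have lt_t : K * n < p ^ t.+1 by rewrite trunc_log_ltn// prime_gt1.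
have le_n : n <= K * n by rewrite leq_pmull//; lia.
rewrite !(@logn_fact_trunc _ _ t)// ?(leq_ltn_trans le_n)//.
have -> : K * t = \sum_(1 <= k < t.+1) K
  by rewrite sum_nat_const_nat subn1 mulnC.
rewrite big_distrr -big_split/=; apply: leq_sum => k _.
have d0 : 0 < p ^ k by rewrite expn_gt0 prime_gt0.
rewrite -mulnSr -ltnS ltn_divLR//.
have := ltn_ceil n d0; nia.
Qed.

(* A prime of block [k = p %/ n] gets weight [K %/ k]; [maxn 1] makes the weight
[K] in block 0. *)
Lemma fact_mul_le (K n : nat) : 1 < K < n ->
  (K * n)`! <= n`! ^ K *
    (K * n) ^ (\sum_(0 <= p < K * n | prime p) K %/ maxn 1 (p %/ n)).
Proof.
move=> /andP[K1 ltKn]; have Kn0 : 0 < K * n by nia.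
rewrite expn_sum (@fact_prod_logn (K * n) (K * n))//.
rewrite [in X in _ <= X](@fact_prod_logn n (K * n)); last by nia.
(* As [K * n] is composite, the range can stop before it and then consists of exactly [K] full
   blocks. *)
have npKn : ~~ prime (K * n).
  apply/primePn; right; exists K; last exact: dvdn_mulr.
  by rewrite K1/=; nia.
have drop_last F : \prod_(0 <= p < (K * n).+1 | prime p) F p =
    \prod_(0 <= p < K * n | prime p) F p.
  by rewrite big_mkcond big_nat_recr//= (negbTE npKn) muln1 -big_mkcond.
rewrite !drop_last.
rewrite (big_morph (expn^~ K) (fun a b => expnMn a b K) (exp1n K)) -big_split/=.
apply: leq_prod => p pp.
have p0 := prime_gt0 pp; have p1 := prime_gt1 pp.
have [ltpn|lenp] := ltnP p n.
  rewrite (divn_small ltpn) maxn0 divn1 -expnM.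
  apply: (@leq_trans (p ^ (K * logn p n`! + K * trunc_log p (K * n)))).
    by rewrite leq_pexp2l// logn_fact_mul.
  rewrite expnD [logn _ _ * K]mulnC leq_mul2l; apply/orP; right.
  by rewrite mulnC expnM leq_exp2r ?trunc_logP//; lia.
have n0 : 0 < n by lia.
have k1 : 0 < p %/ n by rewrite divn_gt0.
have -> : maxn 1 (p %/ n) = p %/ n by lia.
(* From [p >= n > K] follows [p ^ 2 > K * n], so only the first power of [p] counts. *)
rewrite (@logn_fact_trunc p (K * n) 1)//; last by rewrite -mulnn; nia.
rewrite big_nat1 expn1.
have [ltKp|lepK] := ltnP (K * n) p.
  by rewrite (divn_small ltKp) muln_gt0 !expn_gt0 Kn0 p0.
apply: leq_trans (leq_pmull _ _); last by rewrite !expn_gt0 p0.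
apply: (@leq_trans ((K * n) ^ (K * n %/ p))).
  by have [->//|?] := posnP (K * n %/ p); rewrite leq_exp2r.
rewrite leq_pexp2l// leq_divRL//.
apply: (@leq_trans ((K * n %/ p * p) %/ n)).
  by rewrite leq_divRL// -mulnA leq_mul// leq_divM.
by rewrite -[X in _ <= X](mulnK K n0) leq_div2r// leq_divM.
Qed.

(** * Weighted counts of primes, block by block *)

Lemma sum_block_primes (K n : nat) (e : nat -> nat) : 0 < n ->
  \sum_(0 <= p < K * n | prime p) e (p %/ n) =
  \sum_(0 <= k < K) e k * #|[set j : 'I_n | prime (k * n + j)]|.
Proof.
move=> n0; rewrite big_mkcond big_nat_mul; apply: eq_bigr => k _.
rewrite mulSn -{1}[k * n]add0n big_addn addnK big_mkord.
rewrite -sum1_card big_distrr/= [RHS]big_mkcond/=.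
apply: eq_bigr => j _; rewrite inE addnC muln1.
by rewrite divnMDl// divn_small ?addn0.
Qed.

Lemma fact_le_expn (n : nat) : n`! <= n ^ n.
Proof.
elim: n => // n IHn; rewrite factS expnS leq_mul//.
by apply: leq_trans IHn _; case: n => // n; rewrite leq_exp2r.
Qed.

(** Needed for block 0 alone, where primes up to [m] may occur; they lie among the [m + 1] integers
    from 0 to [m]. *)
Lemma leq_card_primes (n m : nat) :
  #|[set j : 'I_n | prime j]%SET| <=
  #|[set j : 'I_n | prime j && (m < j)]%SET| + m.+1.
Proof.
rewrite -(cardsID [set j : 'I_n | m < j]%SET) leq_add//.
  by apply/subset_leq_card/fintype.subsetP => j; rewrite !inE.
set D := (_ :\: _)%SET.
have inord_inj : {in D &, injective (fun j : 'I_n => inord j : 'I_m.+1)}.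
  move=> j k; rewrite !inE -!leqNgt => /andP[jm _] /andP[km _] /(congr1 val)/=.
  by rewrite (inordK jm) (inordK km) => jk; apply/val_inj.
by rewrite -(card_in_imset inord_inj) -[X in _ <= X]card_ord max_card.
Qed.

Lemma sum_weight_primes_le (K n m : nat) : 0 < K -> m < n ->
    (forall i, #|[set j : 'I_n | prime (i + j) && (m < i + j)]%SET| < m) ->
  \sum_(0 <= p < K * n | prime p) K %/ maxn 1 (p %/ n) <=
  K * m.*2 + \sum_(1 <= k < K) K %/ k * m.
Proof.
move=> K0 ltmn few.
rewrite (@sum_block_primes K n (fun k => K %/ maxn 1 k)); last by lia.
rewrite big_ltn// maxn0 divn1 mul0n leq_add//.
  rewrite leq_mul//; apply: leq_trans (leq_card_primes n m) _.
  (* At most [m - 1] primes above [m] and at most [m + 1] others add up to at most [2 * m]. *)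
  have : #|[set j : 'I_n | prime j && (m < j)]%SET| < m := few 0.
  lia.
rewrite big_nat [X in _ <= X]big_nat; apply: leq_sum => k /andP[k1 _].
rewrite (maxn_idPr k1) leq_mul// ltnW//; apply: leq_ltn_trans (few (k * n)).
apply/subset_leq_card/fintype.subsetP => j; rewrite !inE => ->/=.
by rewrite (leq_trans ltmn)//; nia.
Qed.

End PrimesInBlocks.

Local Open Scope classical_set_scope.
Local Open Scope ring_scope.

Section RealBounds.
Variable R : realType.

(** * Logarithmic estimates for harmonic sums and factorials *)

Lemma ln_succ_sub_ge (k : nat) : (0 < k)%N ->
  k.+1%:R^-1 <= ln k.+1%:R - ln k%:R :> R.
Proof.
move=> k0; have k1 : (0 : R) < k%:R by rewrite ltr0n.
have k2 : (0 : R) < k.+1%:R by rewrite ltr0n.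
have kE : k.+1%:R = k%:R + 1 :> R by rewrite -natr1.
rewrite -[leRHS]opprB -ln_div ?posrE// lerNr.
have -> : k%:R / k.+1%:R = 1 + (- k.+1%:R^-1) :> R by rewrite kE; field; lra.
apply: le_ln1Dx; rewrite ltrN2 invf_lt1//; lra.
Qed.

Lemma harmonic_le (K : nat) : (0 < K)%N ->
  \sum_(1 <= k < K.+1) k%:R^-1 <= 1 + ln K%:R :> R.
Proof.
elim: K => // K IHK _; have [->|K0] := posnP K.
  by rewrite big_nat1 ln1 addr0 invr1.
rewrite big_nat_recr//=; apply: le_trans (lerD (IHK K0) (ln_succ_sub_ge K0)) _.
by rewrite addrC addrA addrAC subrK addrC.
Qed.

(** A weak Stirling bound: the induction step amounts to [N * ln (1 + 1 / N) <= 1]. *)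
Lemma ln_fact_ge (N : nat) : N%:R * ln N%:R - N%:R <= ln N`!%:R :> R.
Proof.
elim: N => [|N IHN]; first by rewrite mul0r subr0 fact0 ln1.
have [->|N0] := posnP N; first by rewrite -[1`!]/1%N !ln1 mulr0 sub0r lerN10.
rewrite factS natrM lnM ?posrE ?ltr0n ?fact_gt0//.
have N1 : (0 : R) < N%:R by rewrite ltr0n.
have NE : N.+1%:R = N%:R + 1 :> R by rewrite -natr1.
suff : N%:R * (ln N.+1%:R - ln N%:R) <= 1 :> R by rewrite NE in IHN *; lra.
rewrite -ln_div ?posrE ?ltr0n//.
have -> : N.+1%:R / N%:R = 1 + N%:R^-1 :> R by rewrite NE; field; lra.
rewrite mulrC -ler_pdivlMr// mul1r le_ln1Dx//.
by rewrite (lt_trans (ltrN10 _))// invr_gt0.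
Qed.

Lemma few_primes_bound (K n m : nat) : (1 < K < n)%N -> (m < n)%N ->
    (forall i, #|[set j : 'I_n | prime (i + j) && (m < i + j)%N]%SET| < m)%N ->
  n%:R * (ln K%:R - 1) <= m%:R * (3 + ln K%:R) * (ln K%:R + ln n%:R) :> R.
Proof.
move=> Kn ltmn few; have /andP[K1 ltKn] := Kn.
have := @fact_mul_le K n Kn; set E := (\sum_(_ <= p < _ | _) _)%N => leE.
have [Kgt0 ngt0] : (0 < K)%N /\ (0 < n)%N by lia.
have [K0 n0] : (0 : R) < K%:R /\ (0 : R) < n%:R by rewrite !ltr0n.
(* The constant 3 is 2 from block 0 plus 1 from the harmonic sum over the other blocks. *)
have E_le : E%:R <= K%:R * (m%:R * (3 + ln K%:R)) :> R.
  have /(_ (ltnW K1) ltmn few) := @sum_weight_primes_le K n m.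
  rewrite -/E -(ler_nat R) natrD natr_sum => /le_trans; apply.
  have := harmonic_le Kgt0; rewrite big_nat_recr//=.
  set H := \sum_(_ <= _ < _) _.
  have Kinv0 : 0 < K%:R^-1 :> R by rewrite invr_gt0.
  move=> H_le; have {Kinv0}H_le : H <= 1 + ln K%:R by lra.
  have : \sum_(1 <= k < K) (K %/ k * m)%:R <= K%:R * m%:R * H.
    rewrite mulr_sumr big_nat [leRHS]big_nat; apply: ler_sum => k /andP[k0 _].
    rewrite natrM mulrAC ler_wpM2r// ler_pdivlMr ?ltr0n// -natrM ler_nat.
    exact: leq_divM.
  move=> sum_le; apply: le_trans (lerD (lexx _) sum_le) _.
  rewrite -muln2 !natrM -subr_ge0.
  set t := (X in 0 <= X).
  have -> : t = K%:R * m%:R * (1 + ln K%:R - H) by rewrite /t; ring.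
  by rewrite !mulr_ge0// subr_ge0.
have lnKn : ln (K * n)%:R = ln K%:R + ln n%:R :> R by rewrite natrM lnM ?posrE.
have lnKn0 : 0 <= ln K%:R + ln n%:R :> R.
  by rewrite addr_ge0// ln_ge0// ler1n.
have : ln (K * n)`!%:R <=
    K%:R * (n%:R * ln n%:R) + E%:R * (ln K%:R + ln n%:R) :> R.
  have leF : ((K * n)`! <= (n ^ n) ^ K * (K * n) ^ E)%N.
    by rewrite (leq_trans leE)// leq_mul2r leq_exp2r ?fact_le_expn ?orbT.
  have F0 : (0 < (K * n)`!)%N := fact_gt0 _.
  apply: (@le_trans _ _ (ln ((n ^ n) ^ K * (K * n) ^ E)%:R)).
    by rewrite ler_ln ?posrE ?ltr0n ?ler_nat// (leq_trans F0).
  rewrite natrM lnM ?posrE ?ltr0n ?expn_gt0 ?muln_gt0 ?expn_gt0 ?Kgt0 ?ngt0//.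
  rewrite !natrX !lnXn ?exprn_gt0 ?ltr0n ?muln_gt0 ?Kgt0 ?ngt0// lnKn.
  by rewrite -(mulr_natl (ln _)) -(mulr_natl (_ * _)) -(mulr_natl (_ + _)).
have := ln_fact_ge (K * n); rewrite lnKn natrM => fact_ge fact_le.
have E_le' := ler_wpM2r lnKn0 E_le.
have := le_trans fact_ge (le_trans fact_le (lerD (lexx _) E_le')).
(* The terms [K * n * ln n] on both sides cancel, leaving [K] times the claim. *)
rewrite -subr_ge0 => bound; rewrite -(ler_pM2l K0) -subr_ge0.
by apply: etrans bound; congr (_ <= _); ring.
Qed.

(** * Choice of [K], [n] and [m] *)

Lemma exp2_le_cpx (B : set nat) (K n m : nat) :
    (forall b, B b -> (1 < b)%N) -> (1 < K < n)%N -> (m < n)%N ->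
    m%:R * (3 + ln K%:R) * (ln K%:R + ln n%:R) < n%:R * (ln K%:R - 1) :> R ->
  (2 ^ m <= cpx (admissible_shift B) n)%N.
Proof.
move=> B1 Kn ltmn; apply: contraPT => small; apply/negP; rewrite -leNgt.
apply: few_primes_bound => // i; rewrite ltnNge.
by apply: contra small => /cpx_ge_exp2; apply.
Qed.

(** Squaring [expR (ln y / 2) >= 1 + ln y / 2] gives [y >= (ln y / 2) ^ 2]. *)
Lemma ln_sqr_le (y : R) : 0 < y -> 0 <= ln y -> ln y ^+ 2 <= 4 * y.
Proof.
move=> y0 lny0; have yE : y = expR (ln y / 2) ^+ 2.
  by rewrite expr2 -expRD -splitr lnK.
rewrite [in leRHS]yE; have := expR_ge1Dx (ln y / 2); nra.
Qed.

(** Here [L] stands for [ln K] and [x] for [ln n]. After multiplication by [x / n], the deficit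
    [4 * x] is paid by [d * L * x], and the terms without [x], at most [(3 + L) * (L + 8)], by
    [3 * d * x]. The 8 covers the summand 1 in the bound on [m]. *)
Lemma prime_count_margin (d L x n m : R) :
    0 < d < 1 -> 4 / d <= L -> (3 + L) * (L + 8) / d <= x ->
    x ^+ 2 <= 4 * n -> m <= (1 - d) * (n / x) + 1 ->
  m * (3 + L) * (L + x) < n * (L - 1).
Proof.
move=> /andP[d0 d1]; rewrite !ler_pdivrMr// => dL dx xn m_le.
have L4 : 4 < L by nra.
have x8 : 8 + L < x by nra.
have x0 : 0 < x by lra.
have n0 : 0 < n by nra.
have S0 : 0 < (3 + L) * (L + x) by nra.
rewrite -mulrA; apply: le_lt_trans (ler_wpM2r (ltW S0) m_le) _.
have -> : ((1 - d) * (n / x) + 1) * ((3 + L) * (L + x)) =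
    (((1 - d) * (3 + L) * (L + x)) * n + x * (3 + L) * (L + x)) / x.
  by field; lra.
rewrite ltr_pdivrMr//.
have : x * (L + x) <= 8 * n.
  have : x * L <= x ^+ 2 by rewrite expr2 ler_wpM2l//; lra.
  by rewrite mulrDr -expr2; lra.
have L3 : 0 <= 3 + L by lra.
move=> /(ler_wpM2l L3) h.
have : 0 < n * ((L - 1) * x - (1 - d) * (3 + L) * (L + x) - 8 * (3 + L)).
  rewrite mulr_gt0//.
  have : (1 - d) * ((3 + L) * L) <= (3 + L) * L by rewrite ler_piMl//; nra.
  have : 4 * x <= d * L * x by rewrite ler_wpM2r//; lra.
  have : 0 < d * x by rewrite mulr_gt0.
  lra.
lra.
Qed.

Lemma near_exp2_le_cpx (B : set nat) (d : R) :
    (forall b, B b -> (1 < b)%N) -> 0 < d < 1 ->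
  \forall n \near \oo, 1 < n%:R :> R /\ exists2 m : nat,
    (1 - d) * (n%:R / ln n%:R) <= m%:R &
    (2 ^ m <= cpx (admissible_shift B) n)%N.
Proof.
move=> B1 d01; have /andP[d0 d1] := d01.
(* [K] depends on [d] only and is fixed before [n] grows. *)
pose K := (Num.truncn (expR (4 / d))).+1.
have ltK : expR (4 / d) < K%:R := truncnS_gt _.
have K0 : 0 < K%:R :> R by rewrite ltr0n.
have lnK_ge : 4 / d <= ln K%:R.
  by rewrite -ler_expR lnK ?posrE// ltW.
have K1 : (1 < K)%N.
  rewrite ltnS truncn_gt0 -expR0 ler_expR divr_ge0//; lra.
have L4 : 4 < ln K%:R :> R by move: lnK_ge; rewrite ler_pdivrMr//; nra.
pose X : R := (3 + ln K%:R) * (ln K%:R + 8) / d.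
near=> n.
have ltKn : (K < n)%N by near: n; exact: nbhs_infty_gt.
have n0 : 0 < n%:R :> R by rewrite ltr0n; lia.
have leXn : X <= ln n%:R.
  by rewrite -ler_expR lnK ?posrE//; near: n; exact: nbhs_infty_ger.
split; first by rewrite ltr1n; lia.
have X0 : 0 < X by rewrite divr_gt0// mulr_gt0//; lra.
have x0 : 0 < ln n%:R :> R by lra.
pose s : R := (1 - d) * (n%:R / ln n%:R).
have s0 : 0 <= s by rewrite mulr_ge0 ?divr_ge0 ?subr_ge0 ?(ltW d1) ?(ltW x0).
(* Rounding [s] upwards keeps [m >= s] and costs at most 1. *)
pose m := (Num.truncn s).+1; exists m; first exact: ltW (truncnS_gt _).
have m_le : m%:R <= s + 1 by rewrite -natr1 lerD2r truncn_le.
have margin := prime_count_margin d01 lnK_ge leXn (ln_sqr_le n0 (ltW x0)) m_le.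
apply: (exp2_le_cpx B1 _ _ margin); first by rewrite K1.
(* If [n <= m], then [n * (L - 1) <= m * (3 + L) * (L + x)] with [L = ln K] and [x = ln n], against
   [margin]. *)
rewrite -(ltr_nat R) ltNge; apply/negP => lenm.
move: margin; rewrite ltNge => /negP; apply.
have m0 : 0 <= m%:R :> R by [].
apply: (@le_trans _ _ (m%:R * (ln K%:R - 1))).
  by rewrite ler_wpM2r//; lra.
by rewrite -mulrA ler_wpM2l//; nra.
Unshelve. all: by end_near. Qed.

(** * From a loss [d] in the exponent to a base tending to 2 *)

Lemma powR2_ge (d : R) : 0 <= d -> 2 - 2 * d <= 2 `^ (1 - d).
Proof.
move=> d0; rewrite powRD ?pnatr_eq0 ?implybT// powRr1//.
have -> : 2 - 2 * d = 2 * (1 - d) :> R by ring.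
(* By [expR (- d * ln 2) >= 1 - d * ln 2], it is enough that [ln 2 <= 1]. *)
rewrite ler_pM2l// /powR pnatr_eq0/=.
apply: le_trans (expR_ge1Dx _); rewrite mulNr lerD2l lerN2 ler_piMr//.
have -> : 2 = 1 + 1 :> R by [].
by apply: le_ln1Dx; lra.
Qed.

End RealBounds.

Theorem proposition1p1 (R : realType) (B : set nat)
  (B_gt1 : forall b : nat, B b -> (1 < b)%N)
  (B_primitive : primitive_set B) :
  exists2 eps : nat -> R, eps n @[n --> \oo] --> (0 : R) &
    \forall n \near \oo,
      (2 + eps n) `^ (n%:R / ln n%:R) <= (cpx (admissible_shift B) n)%:R.
Proof.
pose c n : R := (cpx (admissible_shift B) n)%:R.
have c0 n : 0 <= c n by [].
(* This base is at most the exact root of [c n], so the inequality is immediate once the exponent is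
   positive. Capping at 2 makes the error nonpositive, so its convergence needs only a lower
   bound. *)
exists (fun n => Num.min 2 (c n `^ (n%:R / ln n%:R)^-1) - 2); last first.
  (* The value 1/2 is arbitrary; it serves to obtain [1 < n] for large [n]. *)
  have half01 : 0 < (2^-1 : R) < 1 by apply/andP; split; lra.
  apply: filterS (near_exp2_le_cpx B_gt1 half01) => n [n1 _]; rewrite -/(c n).
  have s0 : 0 < n%:R / ln n%:R :> R.
    by rewrite divr_gt0 ?ln_gt0// (lt_trans ltr01).
  rewrite addrC subrK.
  apply: (@le_trans _ _ ((c n `^ (n%:R / ln n%:R)^-1) `^ (n%:R / ln n%:R))).
    rewrite ge0_ler_powR ?nnegrE ?(ltW s0)// ?powR_ge0//; last first.
      by rewrite ge_min lexx orbT.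
    by rewrite le_min powR_ge0 ler0n.
  by rewrite -powRrM mulVf ?gt_eqF// powRr1.
apply/cvgrPdist_le => e e0.
pose d : R := Num.min (e / 2) 2^-1.
have d01 : 0 < d < 1.
  have [/andP[half0 half1] e20] : 0 < (2^-1 : R) < 1 /\ 0 < e / 2.
    by split; [apply/andP; split|]; lra.
  by rewrite lt_min e20 half0 gt_min half1 orbT.
have de : 2 * d <= e by rewrite -ler_pdivlMl// mulrC ge_min lexx.
apply: filterS (near_exp2_le_cpx B_gt1 d01) => n [n1 [m m_ge m_le]].
have s0 : 0 < n%:R / ln n%:R :> R.
  by rewrite divr_gt0 ?ln_gt0// (lt_trans ltr01).
rewrite sub0r opprB ger0_norm ?subr_ge0 ?ge_min ?lexx// lerBlDr -lerBlDl.
have d_ge0 : 0 <= d by case/andP: d01 => /ltW.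
rewrite le_min gerBl (ltW e0)/=.
(* The chain is [2 - e <= 2 - 2 * d <= 2 ^ (1 - d) <= 2 ^ (m / s) <= c n ^ (1 / s)] with
   [s = n / ln n]. *)
apply: (@le_trans _ _ (2 `^ (1 - d))).
  by apply: le_trans (powR2_ge d_ge0); rewrite lerD2l lerN2.
apply: (@le_trans _ _ (2 `^ (m%:R / (n%:R / ln n%:R)))).
  by rewrite ler_powR ?ler1n// ler_pdivlMr.
rewrite powRrM powR_mulrn//.
rewrite ge0_ler_powR ?nnegrE ?invr_ge0 ?(ltW s0) ?exprn_ge0//.
by rewrite -natrX ler_nat.
Qed.
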